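(* Let $H$ be an $\ell$-uniform hypergraph which is not $\ell$-partite, and let $k$ be a positive integer. Then $$R_{\mathrm{list}}(H,k)\ge e^{c_\ell\sqrt{k}},\qquad\text{where } \frac{1}{c_\ell}=2\ell e^{\ell/2}.$$
   Context: $K_n^{(\ell)}$ is the complete $\ell$-uniform hypergraph on $n$ vertices. Given an assignment $L$ of a set $L_e\subseteq\mathbb{N}$ to each edge $e$ of $K_n^{(\ell)}$, an $L$-colouring is a function $c:E(K_n^{(\ell)})\to\mathbb{N}$ with $c(e)\in L_e$ for all $e$. For an $\ell$-uniform hypergraph $H$ and a positive integer $k$, the list Ramsey number $R_{\mathrm{list}}(H,k)$ is the smallest $n$ for which there exists an assignment $L$ of lists with $|L_e|=k$ for every $e\in E(K_n^{(\ell)})$ such that every $L$-colouring of $E(K_n^{(\ell)})$ contains a monochromatic copy of $H$ (a not necessarily induced subhypergraph isomorphic to $H$ all of whose edges have the same colour). An $\ell$-uniform hypergraph is $\ell$-partite if its vertex set can be partitioned into $\ell$ parts such that every edge contains exactly one vertex from each part. *)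

(* Defs.v *)
From HB Require Import structures.
From mathcomp Require Import all_boot all_order all_algebra.
From mathcomp Require Import finmap.
From mathcomp Require Import reals sequences exp.

Set Implicit Arguments.
Unset Strict Implicit.
Unset Printing Implicit Defensive.

Import Order.TTheory GRing.Theory Num.Theory.

(* A finite hypergraph is a vertex type [T : finType] together with its edge
   set [E : {set {set T}}]. *)

Definition uniform_hypergraph (T : finType) (l : nat) (E : {set {set T}}) : Prop :=
  forall e : {set T}, e \in E -> #|e| = l.

(* The partition is given by the map [part] sending a vertex to its part, so a
   part is allowed to be empty; this only matters when [E] is empty. *)
Definition partite_hypergraph (T : finType) (l : nat) (E : {set {set T}}) : Prop :=
  exists part : T -> 'I_l,
    forall e : {set T}, e \in E ->
    forall i : 'I_l, #|[set v in e | part v == i]| = 1%N.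

Definition complete_hypergraph (n l : nat) : {set {set 'I_n}} :=
  [set e : {set 'I_n} | #|e| == l].

(* [F] is the edge set of a hypergraph on vertices of [S] isomorphic to
   [(T, E)]; the injection [phi] takes care of isolated vertices. *)
Definition is_copy (T S : finType) (E : {set {set T}}) (F : {set {set S}}) : Prop :=
  exists phi : T -> S,
    injective phi /\ F = [set phi @: e | e : {set T} in E].

Definition monochromatic (S : finType) (c : {set S} -> nat) (F : {set {set S}}) : Prop :=
  exists a : nat, forall e : {set S}, e \in F -> c e = a.

(* Only the values of [L] and [c] on the edges of the complete hypergraph are
   relevant; elsewhere they are unconstrained. *)
Definition list_assignment (n l k : nat) (L : {set 'I_n} -> {fset nat}) : Prop :=
  forall e : {set 'I_n}, e \in complete_hypergraph n l -> #|` L e| = k.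

Definition list_colouring (n l : nat) (L : {set 'I_n} -> {fset nat})
    (c : {set 'I_n} -> nat) : Prop :=
  forall e : {set 'I_n}, e \in complete_hypergraph n l -> c e \in L e.

Definition list_ramsey_property (T : finType) (l : nat) (E : {set {set T}})
    (k n : nat) : Prop :=
  exists L : {set 'I_n} -> {fset nat},
    list_assignment l k L /\
    forall c : {set 'I_n} -> nat, list_colouring l L c ->
      exists F : {set {set 'I_n}},
        [/\ F \subset complete_hypergraph n l, is_copy E F & monochromatic c F].

Definition is_list_ramsey_number (T : finType) (l : nat) (E : {set {set T}})
    (k N : nat) : Prop :=
  list_ramsey_property l E k N /\
  forall n : nat, list_ramsey_property l E k n -> (N <= n)%N.

Local Open Scope ring_scope.

Definition ramsey_const (R : realType) (l : nat) : R :=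
  (2 * l%:R * expR (l%:R / 2))^-1.

(* Main.v *)
Require Import Defs.
From mathcomp Require Import all_boot all_order all_algebra.
From mathcomp Require Import finmap.
From mathcomp Require Import reals sequences exp.
From mathcomp Require Import ring lra.

Import Order.TTheory GRing.Theory Num.Theory.
Local Open Scope ring_scope.

(** The colouring is found by the probabilistic method.  For every colour [a]
    choose independently a uniformly random map [part a] from the [n] vertices
    to [l] parts, and give an edge [e] any colour [a] of its list for which
    [e] is rainbow, that is, for which [part a] is injective on [e].  If every
    edge receives a colour in this way, then no colour class contains a copy
    of [E]: all edges of colour [a] are transversal to the single partition
    [part a], so a copy of [E] of colour [a] would pull this partition back to
    an [l]-partition of [E].

    An edge is rainbow for one colour with probability [l! / l^l]
    ([card_injective_on]), and so it fails for all [k] colours of its list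
    with probability [(1 - l! / l^l)^k].  By the union bound
    ([exists_sample_meeting_lists]) a good choice exists as soon as
    ['C(n, l) (1 - l! / l^l)^k < 1] ([not_list_ramsey_property]).

    It remains to compare this with the claimed bound
    ([expected_failures_lt1]).  Since [l^l / l! <= exp l], the left-hand side
    is at most [n^l exp (- x^2)], where [x = sqrt k * exp (- l / 2)].  In this
    notation the claimed bound is [exp (x / (2 l))], and a smaller [n]
    satisfies [n^l < exp (x / 2)], which is at most [exp (x^2)] if
    [x >= 1/2].  If [x < 1/2], the claimed bound is below [2], so that [n]
    is at most [1] and there are no edges at all.

    This uses [l >= 2].  A [1]-uniform hypergraph is always [1]-partite, and
    for [l = 0] the constant is the inverse of [0], which is [0], so that only
    [N >= 1] has to be shown; it holds because a hypergraph without vertices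
    is partite. *)

Section Counting.
Local Open Scope nat_scope.

(** A uniformly random map is injective on [e] with probability
    [#|C| ^_ #|e| / #|C| ^ #|e|].  Consider pairs of a map [f] on [V] and a
    map [g] on an indexing of [e]: exchanging [g] with the restriction of [f]
    to [e] is an involution, and it turns the condition that [f] is injective
    on [e] into the condition that [g] is injective. *)
Lemma card_injective_on (V C : finType) (e : {set V}) :
  #|[set f : {ffun V -> C} | dinjectiveb f e]| * #|C| ^ #|e|
  = #|C| ^ #|V| * #|C| ^_ #|e|.
Proof.
pose restr (f : {ffun V -> C}) : {ffun 'I_#|e| -> C} :=
  [ffun j => f (enum_val j)].
pose upd (f : {ffun V -> C}) (g : {ffun 'I_#|e| -> C}) : {ffun V -> C} :=
  [ffun v => if [pick j | enum_val j == v] is Some j then g j else f v].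
pose swap p := (upd p.1 p.2, restr p.1).
have pickE j : [pick j' : 'I_#|e| | enum_val j' == enum_val j] = Some j.
  case: pickP => [j' /eqP/enum_val_inj -> // | /(_ j)]; by rewrite eqxx.
have swapK : involutive swap.
  case=> f g; rewrite /swap /upd /restr /=; congr pair; apply/ffunP => x.
    rewrite !ffunE.
    by case: pickP => [j /eqP <- | _]; rewrite ?ffunE.
  by rewrite !ffunE pickE.
have restr_inj (f : {ffun V -> C}) : dinjectiveb f e = injectiveb (restr f).
  apply/dinjectiveP/injectiveP => inj_f.
    by move=> i j; rewrite /restr !ffunE => /inj_f/enum_val_inj -> //;
      exact: enum_valP.
  move=> x y xe ye eq_f; rewrite -(enum_rankK_in xe xe) -(enum_rankK_in xe ye).
  by congr enum_val; apply: inj_f; rewrite /restr !ffunE !enum_rankK_in.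
have := card_preimset
  (setX [set: {ffun V -> C}] [set g : {ffun 'I_#|e| -> C} | injectiveb g])
  (inv_inj swapK).
rewrite !cardsX cardsT card_inj_ffuns card_ffun card_ord => <-.
rewrite -[in #|C| ^ _](card_ord #|e|) -card_ffun -cardsT -cardsX.
by apply: eq_card => -[f g]; rewrite !inE /= andbT restr_inj.
Qed.

Lemma card_bigcup_le (V X : finType) (A : {set V}) (S : V -> {set X}) :
  #|\bigcup_(v in A) S v| <= \sum_(v in A) #|S v|.
Proof.
elim/big_rec2: _ => [|v n B _ le_Bn]; first by rewrite cards0.
by rewrite (leq_trans (leq_card_setU _ _)) // leq_add2l.
Qed.

(** The union bound for independent samples.  If [f i] is drawn uniformly and
    independently for each [i], and [bad e] has probability at most [p / q],
    then all samples in the list of [e] are bad with probability at most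
    [(p / q) ^ k]; this cannot cover all outcomes if the sum over [A] is below
    [1]. *)
Lemma exists_sample_meeting_lists (I X V : finType) (A : {set V})
    (L : V -> {set I}) (bad : V -> {set X}) (k p q : nat) :
    (forall e, e \in A -> #|L e| = k) ->
    (forall e, e \in A -> #|bad e| * q <= #|X| * p) ->
    0 < #|X| -> #|A| * p ^ k < q ^ k ->
  exists f : I -> X, forall e, e \in A -> exists2 i, i \in L e & f i \notin bad e.
Proof.
move=> cardL card_bad X_gt0 small.
pose S e : {set {ffun I -> X}} :=
  [set f : {ffun I -> X} | [forall i in L e, f i \in bad e]].
have cardS e : e \in A -> #|S e| * q ^ k <= #|X| ^ #|I| * p ^ k.
  move=> eA.
  have -> : #|S e| = \prod_i #|if i \in L e then bad e else setT|.
    transitivity #|family (fun i => mem (if i \in L e then bad e else setT))|.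
      apply: eq_card => f; rewrite inE.
      apply/forall_inP/familyP => f_bad i; last first.
        by move=> iL; have := f_bad i; rewrite iL.
      by case: ifP => [/f_bad // | _]; rewrite inE.
    by rewrite card_family foldrE big_image.
  rewrite -(cardL e eA) -!prod_nat_const.
  rewrite [\prod_(i in L e) q]big_mkcond [\prod_(i in L e) p]big_mkcond.
  rewrite -!big_split /=; apply: leq_prod => i _.
  by case: ifP => _; rewrite ?card_bad // cardsT.
have [f fS | covered] := pickP (fun f : {ffun I -> X} =>
    f \notin \bigcup_(e in A) S e).
  exists f => e eA.
  have : f \notin S e by apply: contra fS => fS; apply/bigcupP; exists e.
  by rewrite inE negb_forall_in => /exists_inP[i iL fi]; exists i.
have : #|X| ^ #|I| * q ^ k <= #|X| ^ #|I| * (#|A| * p ^ k).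
  rewrite mulnCA -sum_nat_const.
  apply: (@leq_trans (\sum_(e in A) #|S e| * q ^ k)); last exact: leq_sum.
  rewrite -big_distrl leq_mul2r /=.
  apply/orP; right; rewrite -card_ffun -cardsT.
  suff -> : [set: {ffun I -> X}] = \bigcup_(e in A) S e by exact: card_bigcup_le.
  by apply/setP=> f; rewrite inE; apply/esym/negbFE/covered.
by rewrite leq_pmul2l ?expn_gt0 ?X_gt0 // leqNgt small.
Qed.

Lemma card_fibre_of_bijection (T : finType) (l : nat) (e : {set T}) (g : T -> 'I_l)
    (i : 'I_l) :
  #|e| = l -> {in e &, injective g} -> #|[set v in e | g v == i]| = 1.
Proof.
move=> card_e inj_g.
have : i \in g @: e.
  suff -> : g @: e = setT by rewrite inE.
  by apply/eqP; rewrite eqEcard subsetT cardsT card_ord card_in_imset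
    ?card_e /=.
case/imsetP=> v ve ->; apply/eqP/cards1P; exists v; apply/setP=> w.
rewrite !inE; apply/andP/eqP => [[we /eqP/inj_g ->] // | -> //].
Qed.

Lemma card_fset_as_ordinals (m : nat) (s : {fset nat}) :
  (forall a, a \in s -> a < m) -> #|[set i : 'I_m | val i \in s]| = #|` s|.
Proof.
move=> bound; rewrite cardE -(size_map val); apply/perm_size/uniq_perm; last first.
- move=> a; apply/mapP/idP => [[i] | a_s].
    by rewrite mem_enum inE => ? ->.
  by exists (Ordinal (bound a a_s)); rewrite ?mem_enum ?inE.
- exact: fset_uniq.
- by rewrite map_inj_uniq ?enum_uniq //; exact: val_inj.
Qed.

(** [(l ^ l - l`!) / l ^ l] is the probability that a fixed edge is not rainbow
    for a random map to [l] parts. *)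
Lemma not_list_ramsey_property (T : finType) (l : nat) (E : {set {set T}})
    (k n : nat) :
    uniform_hypergraph l E -> ~ partite_hypergraph l E -> 0 < l ->
    'C(n, l) * (l ^ l - l`!) ^ k < (l ^ l) ^ k ->
  ~ list_ramsey_property l E k n.
Proof.
move=> hE hpart l_gt0 small [L [cardL ramsey]].
(* Only the colours below [m] occur in lists, so finitely many samples do. *)
pose m := (\max_(e : {set 'I_n}) \max_(a <- L e) a).+1.
have bound e a : a \in L e -> a < m.
  move=> aL; rewrite ltnS; apply: leq_trans (leq_bigmax e).
  exact: leq_bigmax_seq.
pose L' e := [set i : 'I_m | val i \in L e].
pose bad e := [set f : {ffun 'I_n -> 'I_l} | ~~ dinjectiveb f e].
have [|||| part rainbow] := @exists_sample_meeting_lists _ _ _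
    (complete_hypergraph n l) L' bad k (l ^ l - l`!) (l ^ l).
- by move=> e eK; rewrite card_fset_as_ordinals ?cardL // => a; exact: bound.
- move=> e; rewrite inE => /eqP card_e.
  have -> : bad e = ~: [set f : {ffun 'I_n -> 'I_l} | dinjectiveb f e].
    by apply/setP=> f; rewrite !inE.
  have := card_injective_on _ 'I_l e; rewrite card_e !card_ord ffactnn => cardE.
  rewrite cardsCs setCK card_ffun !card_ord.
  by rewrite mulnBl cardE mulnBr.
- by rewrite card_ffun !card_ord expn_gt0 l_gt0.
- by rewrite card_draws card_ord.
have colours e : exists a, e \in complete_hypergraph n l ->
    (a \in L e) && [exists i : 'I_m, (val i == a) && dinjectiveb (part i) e].
  have [eK | ] := boolP (e \in complete_hypergraph n l); last by exists 0.
  have [i] := rainbow e eK; rewrite !inE negbK => iL inj_i.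
  by exists (val i) => _; rewrite iL; apply/existsP; exists i; rewrite eqxx.
have [c cP] := fin_all_exists colours.
have [|F [FK [phi [phi_inj F_def]] [a mono]]] := ramsey c.
  by move=> e /cP/andP[].
(* If [a] is not below [m], then no edge has colour [a], and the default
   colour [ord0] is as good as any. *)
case: hpart; exists (part (insubd ord0 a) \o phi) => e eE i.
have phi_e : phi @: e \in F by rewrite F_def imset_f.
apply: (card_fibre_of_bijection _ _ _ _ _ (hE e eE)) => x y xe ye /= eq_part.
have /cP/andP[_ /existsP[j /andP[/eqP ja inj_j]]] := subsetP FK _ phi_e.
have jE : insubd ord0 a = j by apply/val_inj; rewrite -(mono _ phi_e) -ja valKd.
apply: phi_inj; move/dinjectiveP: inj_j; apply; rewrite ?imset_f //.
by rewrite -jE.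
Qed.

(** Lists of positive size admit some colouring, and the copy which it contains
    has all the vertices of the hypergraph, the isolated ones included. *)
Lemma list_ramsey_property_card (T : finType) (l : nat) (E : {set {set T}})
    (k n : nat) :
  0 < k -> list_ramsey_property l E k n -> #|T| <= n.
Proof.
move=> k_gt0 [L [cardL ramsey]].
have [|F [_ [phi [phi_inj _]] _]] := ramsey (fun e => head 0 (enum_fset (L e))).
  move=> e /cardL cardLe; have: 0 < #|` L e| by rewrite cardLe.
  rewrite -[_ \in L e]/(_ \in enum_fset (L e)).
  by case: (enum_fset (L e)) => // a s _; exact: mem_head.
by rewrite -(card_ord n) -(card_codom phi_inj) max_card.
Qed.

End Counting.

(** [l^l / l!] is one of the terms of the power series of [exp l]. *)
Lemma expRN_le_factorial_ratio (R : realType) (l : nat) :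
  expR (- l%:R) <= l`!%:R / l%:R ^+ l :> R.
Proof.
case: l => [|l]; first by rewrite oppr0 expR0 fact0 expr0 divr1.
rewrite expRN -[leRHS]invf_div lef_pV2 ?posrE ?expR_gt0 ?divr_gt0
  ?exprn_gt0 ?ltr0n ?fact_gt0 //.
by apply: le_trans (expR_ge1Dxn l (ler0n _ _)); rewrite lerDr.
Qed.

Lemma ffact_le_expn (n l : nat) : (n ^_ l <= n ^ l)%N.
Proof.
rewrite ffact_prod -[in leqRHS](card_ord l) -prod_nat_const.
by apply: leq_prod => i _; rewrite leq_subr.
Qed.

Lemma binomial_le_expn (n l : nat) : ('C(n, l) <= n ^ l)%N.
Proof.
apply: leq_trans (ffact_le_expn n l).
by rewrite -bin_ffact leq_pmulr ?fact_gt0.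
Qed.

Lemma rainbow_failure_le (R : realType) (l : nat) :
  (0 < l)%N ->
  (l ^ l - l`!)%:R <= (l ^ l)%:R * expR (- expR (- l%:R)) :> R.
Proof.
move=> l_gt0.
have le_fact : (l`! <= l ^ l)%N.
  by rewrite -ffactnn ffact_le_expn.
have pow_gt0 : 0 < l%:R ^+ l :> R by rewrite exprn_gt0 ?ltr0n.
rewrite natrB // natrX.
have -> : l%:R ^+ l - l`!%:R = l%:R ^+ l * (1 - l`!%:R / l%:R ^+ l) :> R.
  by rewrite mulrBr mulr1 mulrC divfK ?gt_eqF.
rewrite ler_pM2l //; apply: le_trans (expR_ge1Dx _).
by rewrite lerD2l lerN2; exact: expRN_le_factorial_ratio.
Qed.

Lemma expected_failures_lt1 (R : realType) (l k n : nat) :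
  (1 < l)%N -> n%:R < expR (ramsey_const R l * Num.sqrt k%:R) ->
  ('C(n, l) * (l ^ l - l`!) ^ k < (l ^ l) ^ k)%N.
Proof.
move=> l_gt1 n_lt; have l_gt0 : (0 < l)%N by exact: ltnW.
have pow_gt0 : (0 < (l ^ l) ^ k)%N by rewrite !expn_gt0 l_gt0.
have [n_le1 | n_gt1] := leqP n 1.
  by rewrite bin_small // (leq_ltn_trans n_le1).
pose x : R := Num.sqrt k%:R * expR (- (l%:R / 2)).
have x_ge0 : 0 <= x by rewrite mulr_ge0 ?sqrtr_ge0 ?expR_ge0.
have lR_gt0 : 0 < l%:R :> R by rewrite ltr0n.
have cE : ramsey_const R l * Num.sqrt k%:R = x / 2 / l%:R.
  by rewrite /ramsey_const /x expRN !invfM; ring.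
have x2E : x ^+ 2 = k%:R * expR (- l%:R).
  rewrite exprMn sqr_sqrtr ?ler0n // -expRM_natl; congr (_ * expR _).
  by field.
(* Otherwise [expR (x / (2 l)) <= 1 / (1 - 1 / 4)], which is below [2]. *)
have x_ge : 1 / 2 <= x.
  rewrite leNgt; apply/negP => x_lt.
  have : expR (- (x / 2 / l%:R)) * expR (x / 2 / l%:R) = 1.
    by rewrite -expRD addNr expR0.
  have y_le : x / 2 / l%:R <= x / 2.
    by rewrite ler_pdivrMr // ler_peMr ?ler1n // divr_ge0.
  have := expR_ge1Dx (- (x / 2 / l%:R)).
  have n_ge2 : 2 <= n%:R :> R by rewrite ler_nat.
  move: n_lt; rewrite cE; move: (expR _) (expR _) => ? ?; nra.
rewrite -(ltr_nat R) natrM 2!natrX.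
have step : ((l ^ l - l`!)%:R ^+ k : R)
    <= (l ^ l)%:R ^+ k * expR (- (x ^+ 2)).
  rewrite x2E -mulrN expRM_natl -exprMn lerXn2r ?nnegrE ?ler0n //.
    by rewrite mulr_ge0 ?ler0n ?expR_ge0.
  exact: rainbow_failure_le.
apply: le_lt_trans (ler_wpM2l (ler0n _ _) step) _.
rewrite mulrCA -[ltRHS]mulr1 ltr_pM2l; last first.
  by rewrite exprn_gt0 ?ltr0n ?expn_gt0 ?l_gt0.
rewrite expRN ltr_pdivrMr ?expR_gt0 // mul1r.
apply: (@le_lt_trans _ _ (n%:R ^+ l)).
  by rewrite -natrX ler_nat binomial_le_expn.
apply: (@lt_le_trans _ _ (expR (x / 2))).
  have -> : x / 2 = l%:R * (x / 2 / l%:R) by field; rewrite gt_eqF.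
  by rewrite expRM_natl ltrXn2r ?ler0n -?cE // -lt0n.
by rewrite ler_expR; nra.
Qed.

Theorem theorem7 (R : realType) (l : nat) (T : finType) (E : {set {set T}})
    (k N : nat) (hE : uniform_hypergraph l E) (hpart : ~ partite_hypergraph l E)
    (hk : (0 < k)%N) (hN : is_list_ramsey_number l E k N) :
  expR (ramsey_const R l * Num.sqrt (k%:R : R)) <= (N%:R : R).
Proof.
have [hN' _] := hN; have [l_gt1 | l_le1] := ltnP 1 l.
  rewrite leNgt; apply/negP => /(expected_failures_lt1 _ _ _ _ l_gt1) small.
  exact: not_list_ramsey_property hE hpart (ltnW l_gt1) small hN'.
have l0 : l = 0%N.
  case: l l_le1 hE hpart {hN hN'} => [//|[|//]] _ hE [].
  exists (fun _ => ord0) => e eE i; rewrite -[RHS](hE e eE).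
  by apply: eq_card => v; rewrite inE [i]ord1 eqxx andbT.
rewrite /ramsey_const l0 mulr0 mul0r invr0 mul0r expR0 ler1n.
apply: leq_trans (list_ramsey_property_card _ _ _ _ _ hk hN').
rewrite lt0n; apply/negP => /eqP/card0_eq T0; apply: hpart.
have T_empty (v : T) : False by have := T0 v.
exists (fun v => False_rect _ (T_empty v)) => e _ i.
by have := leq_trans (ltn_ord i) (eq_leq l0).
Qed.
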